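(* Let $\lambda\in\mathbb{N}_0^m$, $\alpha\in\mathbb{N}_0^l$, let $T:V(\lambda)\to V(\alpha)$ be a $\mathbb{C}$-linear operator, let $(C_1\times\cdots\times C_m,\;B_1\times\cdots\times B_m)$ be any disjoint Grace pair, and let $S_1,\dots,S_l\subseteq\mathbb{CP}^1$ be any sets. The following are equivalent. (i) $T$ maps $(C_1\times\cdots\times C_m)$-stable polynomials to nonzero $(S_1\times\cdots\times S_l)$-stable polynomials. (ii) $T$ maps $(C_1\times\cdots\times C_m)$-stable evaluation symbols to nonzero $(S_1\times\cdots\times S_l)$-stable polynomials. (iii) $\operatorname{Symb}(T)$ is $(B_1\times\cdots\times B_m)\times(S_1\times\cdots\times S_l)$-stable.
   Context: For $\lambda\in\mathbb{N}_0^m$, $V(\lambda)$ is the complex vector space of polynomials $p(x_1,y_1,\dots,x_m,y_m)$ with complex coefficients that are homogeneous of degree $\lambda_k$ in the pair $(x_k,y_k)$ for each $k$. Points of $\mathbb{CP}^1$ are written $(a:b)$ and identified with $\mathbb{C}\cup\{\infty\}$ via $a/b$. Zeros of $p\in V(\lambda)$ are considered in $(\mathbb{CP}^1)^m$. For $\Omega\subseteq(\mathbb{CP}^1)^m$, $p$ is $\Omega$-stable if it does not vanish in $\Omega$. Apolarity form: $D^\lambda:V(\lambda)\otimes V(\lambda)\to\mathbb{C}$, $D^\lambda:=\prod_{i=1}^m(\partial_{x_i}\otimes\partial_{y_i}-\partial_{y_i}\otimes\partial_{x_i})^{\lambda_i}$; explicitly $D^\lambda(p\otimes q)=\sum_{\mu\le\lambda}\binom{\lambda}{\mu}(-1)^{|\mu|}(\partial_x^{\lambda-\mu}\partial_y^{\mu}p)(\partial_x^{\mu}\partial_y^{\lambda-\mu}q)$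 (multi-index notation). Grace pair: for $S,S'\subseteq(\mathbb{CP}^1)^m$, $(S,S')$ is a Grace pair if for all $\lambda\in\mathbb{N}_0^m$ and all $p,q\in V(\lambda)$ with $p$ $S$-stable and $q$ $S'$-stable one has $D^\lambda(p\otimes q)\ne0$. It is a disjoint Grace pair if it has the form $(C_1\times\cdots\times C_m,B_1\times\cdots\times B_m)$ with $C_k\cap B_k=\varnothing$ for all $k$. Evaluation symbol: a polynomial in $V(\lambda)$ of the form $(bx-ay)^\lambda:=\prod_{j=1}^m(b_jx_j-a_jy_j)^{\lambda_j}$ with $(a_j,b_j)\in\mathbb{C}^2\setminus\{(0,0)\}$ for all $j$. Symbol: for linear $T:V(\lambda)\to V(\alpha)$, $\operatorname{Symb}(T):=T[(zy-xw)^\lambda]=\sum_{\mu\le\lambda}\binom{\lambda}{\mu}z^{\lambda-\mu}(-w)^\mu\,T(x^\mu y^{\lambda-\mu})\in V(\lambda\sqcup\alpha)$, where $\lambda\sqcup\alpha=(\lambda_1,\dots,\lambda_m,\alpha_1,\dots,\alpha_l)$, $T$ acts only on the $x,y$ variables, the pairs $(z_k,w_k)$, $k\le m$, are the first $m$ pairs of variables (of degrees $\lambda_k$) and the $l$ output pairs $(x_j,y_j)$ come last.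
   Formalization: The sets S_1,…,S_l are assumed nonempty instead of arbitrary: if some S_j is empty, (iii) holds vacuously even for T = 0, while (i) and (ii) then fail because stable evaluation symbols exist. *)

(* Defs.v *)
From HB Require Import structures.
From mathcomp Require Import all_boot all_order all_algebra.
From mathcomp Require Import generic_quotient.
From mathcomp Require Import classical_sets.
From mathcomp Require Import mpoly.

Set Implicit Arguments.
Unset Strict Implicit.
Unset Printing Implicit Defensive.

Import GRing.Theory.

Local Open Scope quotient_scope.
Local Open Scope ring_scope.

(* -------------------------------------------------------------------- *)
Section Concatenation.

Definition fcat {T : Type} {m n : nat} (f : 'I_m -> T) (g : 'I_n -> T)
    (i : 'I_(m + n)) : T :=
  match split i with inl j => f j | inr k => g k end.

Lemma fcatl {T : Type} {m n : nat} (f : 'I_m -> T) (g : 'I_n -> T) j :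
  fcat f g (lshift n j) = f j.
Proof. by rewrite /fcat (unsplitK (inl j)). Qed.

Lemma fcatr {T : Type} {m n : nat} (f : 'I_m -> T) (g : 'I_n -> T) k :
  fcat f g (rshift m k) = g k.
Proof. by rewrite /fcat (unsplitK (inr k)). Qed.

Definition mcat {m n : nat} (a : 'X_{1..m}) (b : 'X_{1..n}) : 'X_{1..m + n} :=
  [multinom fcat a b i | i < m + n].

Lemma mcatl m n (a : 'X_{1..m}) (b : 'X_{1..n}) j : mcat a b (lshift n j) = a j.
Proof. by rewrite mnmE fcatl. Qed.

Lemma mcatr m n (a : 'X_{1..m}) (b : 'X_{1..n}) k : mcat a b (rshift m k) = b k.
Proof. by rewrite mnmE fcatr. Qed.

End Concatenation.

(* -------------------------------------------------------------------- *)
Section ProjectiveLine.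

Variable F : fieldType.

Record nzpair := NzPair { pair_of :> F * F; _ : pair_of != 0 }.

HB.instance Definition _ := [isSub for pair_of].
HB.instance Definition _ := [Choice of nzpair by <:].

Definition proportional (u v : nzpair) : bool :=
  (val u).1 * (val v).2 == (val u).2 * (val v).1.

Lemma proportionalP (u v : nzpair) :
  reflect (exists2 c, c != 0 & val v = (c * (val u).1, c * (val u).2))
          (proportional u v).
Proof.
case: u v => [[a b] nz_ab] [[a' b'] nz_ab']; rewrite /proportional /=.
have nzE (x y : F) : ((x, y) != 0) = (x != 0) || (y != 0).
  by rewrite -negb_and.
move: nz_ab nz_ab'; rewrite !nzE => nz_ab nz_ab'.
apply: (iffP eqP) => [e|[c c0 [-> ->]]]; last by rewrite mulrCA [a * b]mulrC mulrCA.
have [a0|a_n0] := eqVneq a 0.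
  move: nz_ab e; rewrite a0 eqxx /= mul0r => b_n0 /esym/eqP.
  rewrite mulf_eq0 (negPf b_n0) /= => /eqP a'0.
  exists (b' / b); last by rewrite mulr0 a'0 divfK.
  by move: nz_ab'; rewrite a'0 eqxx /= => b'0; rewrite mulf_neq0 ?invr_eq0.
have e' : b' = a' / a * b by rewrite mulrAC [a' * b]mulrC -e mulrAC divff ?mul1r.
exists (a' / a); last by rewrite divfK // -e'.
rewrite mulf_neq0 ?invr_eq0 //; apply: contraTneq nz_ab' => a'0.
by rewrite e' a'0 !mul0r eqxx.
Qed.

Lemma proportional_refl : ssrbool.reflexive proportional.
Proof. by move=> u; rewrite /proportional mulrC. Qed.

Lemma proportional_sym : ssrbool.symmetric proportional.
Proof.
by move=> u v; rewrite /proportional eq_sym mulrC [X in _ == X]mulrC.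
Qed.

Lemma proportional_trans : ssrbool.transitive proportional.
Proof.
move=> v u w /proportionalP[c c0 e] /proportionalP[d d0 e'].
apply/proportionalP; exists (d * c); first exact: mulf_neq0.
by rewrite e' e /= !mulrA.
Qed.

Canonical proportional_equiv :=
  EquivRel proportional proportional_refl proportional_sym proportional_trans.

Definition P1 := {eq_quot proportional}.

HB.instance Definition _ := Choice.on P1.
HB.instance Definition _ := EqQuotient.on P1.

(* The point (a : b) of the projective line. *)
Definition P1_point (u : nzpair) : P1 := \pi_P1 u.

Lemma P1_pointP (u v : nzpair) :
  reflect (exists2 c, c != 0 & val v = (c * (val u).1, c * (val u).2))
          (P1_point u == P1_point v).
Proof. by rewrite /P1_point eqmodE; exact: proportionalP. Qed.

End ProjectiveLine.

Arguments P1_point {F} u.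

(* -------------------------------------------------------------------- *)
(* A polynomial in the m pairs of variables (x_k, y_k) is an element of
   {mpoly F[m + m]}: x_k is the variable of index lshift m k and y_k the
   variable of index rshift m k, so that x^a y^b = 'X_[mcat a b]. *)
Section Spaces.

Variable F : fieldType.

Definition xvar {m : nat} (k : 'I_m) : {mpoly F[m + m]} := 'X_(lshift m k).
Definition yvar {m : nat} (k : 'I_m) : {mpoly F[m + m]} := 'X_(rshift m k).

Definition mhomog {m : nat} (lam : 'X_{1..m}) : {pred {mpoly F[m + m]}} :=
  fun p => all (fun mu : 'X_{1..m + m} =>
    [forall k, mu (lshift m k) + mu (rshift m k) == lam k]%N) (msupp p).

Lemma mhomogP m (lam : 'X_{1..m}) (p : {mpoly F[m + m]}) :
  reflect (forall mu, p@_mu != 0 ->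
             forall k, (mu (lshift m k) + mu (rshift m k))%N = lam k)
          (p \in mhomog lam).
Proof.
apply: (iffP allP) => h mu.
  by rewrite -mcoeff_msupp => /h /forallP hk k; apply/eqP.
by rewrite mcoeff_msupp => /h hk; apply/forallP => k; apply/eqP.
Qed.

Lemma mhomog_submod m (lam : 'X_{1..m}) : submod_closed (mhomog lam).
Proof.
split=> [|c p q /mhomogP hp /mhomogP hq]; apply/mhomogP => mu.
  by rewrite mcoeff0 eqxx.
rewrite mcoeffD mcoeffZ => nz k.
have [p0|] := eqVneq p@_mu 0; last by move/hp.
by apply: hq; apply: contraNneq nz => ->; rewrite p0 mulr0 addr0.
Qed.

HB.instance Definition _ m (lam : 'X_{1..m}) :=
  GRing.isSubmodClosed.Build F {mpoly F[m + m]} (mhomog lam)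
    (mhomog_submod lam).

Lemma mhomogX m (lam : 'X_{1..m}) (mu : 'X_{1..m + m}) :
  (forall k, mu (lshift m k) + mu (rshift m k) = lam k)%N ->
  'X_[mu] \in mhomog lam.
Proof.
move=> h; apply/mhomogP => nu.
by rewrite mcoeffX; case: (mu =P nu) => [<- //|_]; rewrite eqxx.
Qed.

Lemma mhomog_xvar m (k : 'I_m) : xvar k \in mhomog U_(k)%MM.
Proof.
apply: mhomogX => j.
by rewrite !mnm1E (inj_eq (@lshift_inj _ _)) eq_lrshift addn0.
Qed.

Lemma mhomog_yvar m (k : 'I_m) : yvar k \in mhomog U_(k)%MM.
Proof.
apply: mhomogX => j.
by rewrite !mnm1E (inj_eq (@rshift_inj _ _)) eq_rlshift.
Qed.

Lemma mhomogM m (a b : 'X_{1..m}) (p q : {mpoly F[m + m]}) :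
  p \in mhomog a -> q \in mhomog b -> p * q \in mhomog (a + b)%MM.
Proof.
move=> /mhomogP hp /mhomogP hq; rewrite (mpolyE p) (mpolyE q) mulr_suml.
rewrite big_seq; apply: rpred_sum => mu; rewrite mcoeff_msupp => /hp hmu.
rewrite mulr_sumr big_seq; apply: rpred_sum => nu.
rewrite mcoeff_msupp => /hq hnu.
rewrite -scalerAl -scalerAr -mpolyXD; do 2!apply: rpredZ.
by apply: mhomogX => k; rewrite !mnmDE addnACA hmu hnu.
Qed.

Lemma mhomog1 m : 1 \in @mhomog m 0%MM.
Proof. by rewrite -mpolyX0; apply: mhomogX => k; rewrite !mnm0E. Qed.

Lemma mhomog_prodXn m (I : finType) (a : I -> 'X_{1..m})
    (f : I -> {mpoly F[m + m]}) (e : I -> nat) :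
  (forall i, f i \in mhomog (a i)) ->
  \prod_i f i ^+ e i \in mhomog (\sum_i a i *+ e i)%MM.
Proof.
move=> h; elim/big_ind2: _ => [||i _]; [exact: mhomog1|by move=> *; exact: mhomogM|].
elim: (e i) => [|n IHn]; first by rewrite mulm0n expr0 mhomog1.
by rewrite mulmS exprS mhomogM.
Qed.

Record V {m : nat} (lam : 'X_{1..m}) :=
  InV { mpoly_of_V :> {mpoly F[m + m]}; _ : mpoly_of_V \in mhomog lam }.

HB.instance Definition _ m (lam : 'X_{1..m}) := [isSub for @mpoly_of_V m lam].
HB.instance Definition _ m (lam : 'X_{1..m}) := [Choice of V lam by <:].
HB.instance Definition _ m (lam : 'X_{1..m}) :=
  [SubChoice_isSubLmodule of V lam by <:].

(* ------------------------------------------------------------------ *)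
Definition coord_point {m : nat} (z : {ffun 'I_m -> P1 F}) : 'I_(m + m) -> F :=
  fcat (fun k => (val (repr (z k))).1) (fun k => (val (repr (z k))).2).

(* p vanishes at z if it does so at some (equivalently, at any, see
   [vanishesP]) choice of homogeneous coordinates of z. *)
Definition vanishes {m : nat} (p : {mpoly F[m + m]})
    (z : {ffun 'I_m -> P1 F}) : bool :=
  p.@[coord_point z] == 0.

Definition stable {m : nat} (Omega : set {ffun 'I_m -> P1 F})
    (p : {mpoly F[m + m]}) : Prop :=
  forall z, Omega z -> ~~ vanishes p z.

Lemma meval_scale m (lam : 'X_{1..m}) (p : {mpoly F[m + m]}) (c a b : 'I_m -> F) :
  p \in mhomog lam ->
  p.@[fcat (fun k => c k * a k) (fun k => c k * b k)] =
  (\prod_k c k ^+ lam k) * p.@[fcat a b].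
Proof.
move=> /mhomogP hp; rewrite !mevalE mulr_sumr.
rewrite big_seq [RHS]big_seq; apply: eq_bigr => mu.
rewrite mcoeff_msupp => /hp hmu; rewrite mulrCA; congr (_ * _).
rewrite !big_split_ord /= -!big_split /=; apply: eq_bigr => k _.
by rewrite !fcatl !fcatr -hmu !exprMn exprD; rewrite mulrACA.
Qed.

Lemma vanishesP m (lam : 'X_{1..m}) (p : V lam) (u : 'I_m -> nzpair F) :
  vanishes p [ffun k => P1_point (u k)] =
  (p.@[fcat (fun k => (val (u k)).1) (fun k => (val (u k)).2)] == 0).
Proof.
have /fin_all_exists[c hc] k : exists c : F, c != 0 /\
    val (repr (P1_point (u k))) = (c * (val (u k)).1, c * (val (u k)).2).
  have /P1_pointP[c c0 e] : P1_point (u k) == P1_point (repr (P1_point (u k))).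
    by rewrite /P1_point reprK.
  by exists c.
rewrite /vanishes.
have -> : p.@[coord_point [ffun k => P1_point (u k)]] =
    p.@[fcat (fun k => c k * (val (u k)).1) (fun k => c k * (val (u k)).2)].
  apply: meval_eq => i; rewrite /coord_point /fcat.
  by case: split => k; rewrite ffunE (hc k).2.
rewrite (meval_scale _ _ _ (valP p)) mulf_eq0 orb_idl // => /prodf_eq0[k _].
by rewrite expf_eq0 (negPf (hc k).1) andbF.
Qed.

(* ------------------------------------------------------------------ *)
Definition prod_set {m : nat} (C : 'I_m -> set (P1 F)) :
    set {ffun 'I_m -> P1 F} :=
  [set z | forall k, C k (z k)]%classic.

Definition mbinom {m : nat} (lam mu : 'X_{1..m}) : nat :=
  \prod_k 'C(lam k, mu k).

(* The summation index ranges over all mu <= lam; the bound on its degree is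
   implied by mu <= lam and only serves to make the index type finite.  The
   products of derivatives are constants ([mderivm_V_const]), whence the
   extraction of their constant coefficients. *)
Definition apolar {m : nat} (lam : 'X_{1..m}) (p q : V lam) : F :=
  \sum_(mu : 'X_{1..m < (mdeg lam).+1} | (mu <= lam)%MM)
     (mbinom lam mu)%:R * (-1) ^+ mdeg mu *
     ((val p)^`M[mcat (lam - mu)%MM mu] *
      (val q)^`M[mcat mu (lam - mu)%MM])@_0%MM.

Lemma mderivm_V_const m (lam a b : 'X_{1..m}) (p : V lam) :
  (forall k, a k + b k = lam k)%N ->
  (val p)^`M[mcat a b] = mpolyC _ ((val p)^`M[mcat a b])@_0%MM.
Proof.
move=> hab; apply/mpolyP => nu; rewrite mcoeffC.
have [->|nu0] := eqVneq 0%MM nu; first by rewrite mulr1.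
rewrite mulr0 mcoeff_mderivm.
have [->|/(mhomogP _ _ (valP p)) hp] := eqVneq (val p)@_(mcat a b + nu)%MM 0.
  by rewrite mul0rn.
case/eqP: nu0; apply/mnmP => i; rewrite mnm0E.
have h k : nu (lshift m k) = 0%N /\ nu (rshift m k) = 0%N.
  have := hp k; rewrite !mnmDE mcatl mcatr addnACA hab -[RHS]addn0.
  by move/addnI/eqP; rewrite addn_eq0 => /andP[/eqP h1 /eqP h2]; split.
by rewrite -(splitK i); case: (split i) => k /=; case: (h k).
Qed.

Definition Grace_pair {m : nat} (S S' : set {ffun 'I_m -> P1 F}) : Prop :=
  forall (lam : 'X_{1..m}) (p q : V lam),
    stable S p -> stable S' q -> apolar p q != 0.

Definition disjoint_Grace_pair {m : nat} (C B : 'I_m -> set (P1 F)) : Prop :=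
  Grace_pair (prod_set C) (prod_set B) /\
  forall k, (C k `&` B k = set0)%classic.

(* ------------------------------------------------------------------ *)
Definition evaluation_symbol {m : nat} (lam : 'X_{1..m}) (p : V lam) : Prop :=
  exists a b : 'I_m -> F, (forall j, (a j, b j) != (0, 0)) /\
    p = \prod_j (b j *: xvar j - a j *: yvar j) ^+ lam j :> {mpoly F[m + m]}.

(* ------------------------------------------------------------------ *)
(* The monomial x^mu y^(lam - mu); the default value 0 is never taken for
   mu <= lam, see [monoVE]. *)
Definition monoV {m : nat} (lam mu : 'X_{1..m}) : V lam :=
  insubd (0 : V lam) 'X_[mcat mu (lam - mu)%MM].

Lemma monoVE m (lam mu : 'X_{1..m}) : (mu <= lam)%MM ->
  monoV lam mu = 'X_[mcat mu (lam - mu)%MM] :> {mpoly F[m + m]}.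
Proof.
move=> /mnm_lepP le_mu; rewrite /monoV [LHS]insubdK //; apply: mhomogX => k.
by rewrite mcatl mcatr mnmBE subnKC.
Qed.

(* Renaming of the l pairs of variables of p as the last l of m + l pairs. *)
Definition embed_last {m l : nat} (p : {mpoly F[l + l]}) :
    {mpoly F[(m + l) + (m + l)]} :=
  p \mPo [tuple fcat (fun j => xvar (rshift m j)) (fun j => yvar (rshift m j)) i
         | i < l + l].

(* The pairs (z_k, w_k) are the first m of the m + l pairs of variables. *)
Definition Symb_poly {m l : nat} (lam : 'X_{1..m}) (al : 'X_{1..l})
    (T : V lam -> V al) : {mpoly F[(m + l) + (m + l)]} :=
  \sum_(mu : 'X_{1..m < (mdeg lam).+1} | (mu <= lam)%MM)
     ((mbinom lam mu)%:R * (-1) ^+ mdeg mu) *: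
     ((\prod_k xvar (lshift l k) ^+ (lam - mu)%MM k) *
      (\prod_k yvar (lshift l k) ^+ mu k) *
      embed_last (T (monoV lam mu))).

Lemma Symb_subproof m l (lam : 'X_{1..m}) (al : 'X_{1..l}) (T : V lam -> V al) :
  Symb_poly T \in mhomog (mcat lam al).
Proof.
apply: rpred_sum => mu /mnm_lepP le_mu; apply: rpredZ.
rewrite /embed_last comp_mpolyE mulr_sumr big_seq; apply: rpred_sum => nu.
rewrite mcoeff_msupp => /(mhomogP _ _ (valP (T _))) hnu.
rewrite -scalerAr; apply: rpredZ.
have -> : mcat lam al = (\sum_k U_(lshift l k) *+ (lam - mu)%MM k +
    \sum_k U_(lshift l k) *+ (val mu) k +
    (\sum_j U_(rshift m j) *+ nu (lshift l j) +
     \sum_j U_(rshift m j) *+ nu (rshift l j)))%MM.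
  apply/mnmP => i; rewrite !mnmDE !mnm_sumE -!big_split /=.
  under eq_bigr do rewrite !mulmnE !mnm1E -mulnDr mnmBE subnK //.
  rewrite [X in _ = (_ + X)%N](eq_bigr (fun j => (rshift m j == i) * al j)%N);
    last by move=> j _; rewrite !mulmnE !mnm1E -mulnDr hnu.
  rewrite -(splitK i); case: (split i) => k /=; rewrite ?mcatl ?mcatr.
    rewrite [X in (_ + X)%N]big1 => [|j _]; last by rewrite eq_rlshift.
    rewrite (bigD1 k) //= eqxx mul1n big1 ?addn0 // => j /negPf jk.
    by rewrite (inj_eq (@lshift_inj _ _)) jk.
  rewrite big1 => [|j _]; last by rewrite eq_lrshift.
  rewrite (bigD1 k) //= eqxx mul1n big1 ?addn0 // => j /negPf jk.
  by rewrite (inj_eq (@rshift_inj _ _)) jk.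
do 2?[apply: mhomogM].
- by apply: mhomog_prodXn => k; exact: mhomog_xvar.
- by apply: mhomog_prodXn => k; exact: mhomog_yvar.
- rewrite big_split_ord /=; apply: mhomogM; apply: mhomog_prodXn => k;
    rewrite tnth_mktuple ?fcatl ?fcatr; [exact: mhomog_xvar|exact: mhomog_yvar].
Qed.

Definition Symb {m l : nat} (lam : 'X_{1..m}) (al : 'X_{1..l})
    (T : V lam -> V al) : V (mcat lam al) :=
  InV (Symb_subproof T).

End Spaces.

(* Main.v *)
(** Write [t] for a point of [S_1 x ... x S_l].  The kernel [Symb(T)(., t)] lies
    in [V(lambda)], and pairing it with [p] by the apolarity form recovers, up to
    the constant [(-1)^|lambda| (lambda!)^2], the value [T(p)(t)].  If [Symb(T)]
    is stable, this kernel is [B]-stable, so [T(p)(t)] is nonzero by the Grace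
    property.  Conversely, specializing the first [m] pairs of variables of [Symb(T)]
    at a point of [B_1 x ... x B_m] gives the image under [T] of an evaluation
    symbol, which vanishes only if some coordinate lies in [B_k]; as [B_k] is
    disjoint from [C_k], this evaluation symbol is [C]-stable. *)
Require Import Defs.
From mathcomp Require Import all_boot all_order all_algebra.
From mathcomp Require Import classical_sets reals.
From mathcomp Require Import complex.
From mathcomp Require Import mpoly.
From mathcomp Require Import generic_quotient ring.

Import GRing.Theory.

Local Open Scope ring_scope.

(** * Sums over the multi-indices below [lam] *)

Lemma lem_subK {m} (lam mu : 'X_{1..m}) :
  (mu <= lam)%MM -> (lam - (lam - mu))%MM = mu.
Proof. by move=> /mnm_lepP h; apply/mnmP => i; rewrite !mnmBE subKn. Qed.

Lemma mdeg_lem {m} {lam mu : 'X_{1..m}} :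
  (mu <= lam)%MM -> (mdeg mu < (mdeg lam).+1)%N.
Proof. by move=> h; rewrite ltnS -(submK h) mdegD leq_addl. Qed.

Lemma big_lem_rev {m} (A : nmodType) (lam : 'X_{1..m}) (G : 'X_{1..m} -> A) :
  \sum_(mu : 'X_{1..m < (mdeg lam).+1} | (mu <= lam)%MM) G mu =
  \sum_(mu : 'X_{1..m < (mdeg lam).+1} | (mu <= lam)%MM) G (lam - mu)%MM.
Proof.
have lt_sub (mu : 'X_{1..m < (mdeg lam).+1}) :
  (mdeg (lam - mu) < (mdeg lam).+1)%N by rewrite ltnS mdegB.
pose h mu := BMultinom (lt_sub mu).
rewrite (reindex_onto h h) => [|mu le_mu]; last first.
  by apply: val_inj; rewrite /= lem_subK.
apply: eq_bigl => mu; rewrite /= lem_subr; apply/eqP/idP => [<-|le_mu].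
  exact: lem_subr.
by apply: val_inj; rewrite /= lem_subK.
Qed.

(** Distributivity: choosing an index at most [lam k] in each factor amounts to choosing a
    multi-index below [lam]. *)
Lemma prod_sum_lem {m} (A : comNzRingType) (lam : 'X_{1..m})
    (G : 'I_m -> nat -> A) :
  \prod_k \sum_(i < (lam k).+1) G k i =
  \sum_(mu : 'X_{1..m < (mdeg lam).+1} | (mu <= lam)%MM) \prod_k G k (mu k).
Proof.
have le_deg (nu : 'X_{1..m}) k : (nu k <= mdeg nu)%N.
  by rewrite mdegE (bigD1 k) //= leq_addr.
have lt_deg (mu : 'X_{1..m < (mdeg lam).+1}) k : (mu k < (mdeg lam).+1)%N.
  exact: leq_ltn_trans (le_deg _ _) (bmdeg mu).
(* Widening every inner sum to one common range lets the choices form an ordinary finite function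
   type. *)
under eq_bigr => k _ do
  rewrite (big_ord_widen (mdeg lam).+1 (G k)) ?ltnS ?le_deg //.
rewrite bigA_distr_big_dep.
pose h (mu : 'X_{1..m < (mdeg lam).+1}) : {ffun 'I_m -> 'I_(mdeg lam).+1} :=
  [ffun k => Ordinal (lt_deg mu k)].
pose to_mnm (f : {ffun 'I_m -> 'I_(mdeg lam).+1}) : 'X_{1..m} :=
  [multinom (f k : nat) | k < m].
(* A choice function may exceed the degree bound; the default [bm0] absorbs this case, which never
   occurs below [lam]. *)
pose h' f : 'X_{1..m < (mdeg lam).+1} := insubd bm0 (to_mnm f).
have h'E f : (to_mnm f <= lam)%MM -> h' f = to_mnm f :> 'X_{1..m}.
  by move=> /mdeg_lem lt_f; rewrite [LHS]insubdK.
have to_mnmK mu : to_mnm (h mu) = mu.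
  by apply/mnmP => k; rewrite mnmE ffunE.
rewrite (reindex_onto h h') => [|f /familyP f_le]; last first.
  apply/ffunP => k; apply: val_inj; rewrite ffunE /= h'E ?mnmE //.
  by apply/mnm_lepP => i; rewrite mnmE -ltnS; exact: f_le.
apply: eq_big => [mu|mu _]; last by apply: eq_bigr => k _; rewrite ffunE.
apply/andP/idP => [[/familyP le_mu _]|le_mu].
  by apply/mnm_lepP => k; have := le_mu k; rewrite ffunE.
split; last by apply/eqP/val_inj; rewrite /= h'E to_mnmK.
by apply/familyP => k; rewrite ffunE unfold_in /= ltnS; exact/mnm_lepP.
Qed.

(** * The monomial basis and the apolarity form in coordinates *)

Section ApolarityKernel.

Variable F : fieldType.

Lemma coefV_sum {m} (lam nu : 'X_{1..m}) (a : 'X_{1..m} -> F) :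
  (nu <= lam)%MM ->
  (val (\sum_(mu : 'X_{1..m < (mdeg lam).+1} | (mu <= lam)%MM)
     a mu *: monoV F lam mu))@_(mcat nu (lam - nu)%MM) = a nu.
Proof.
move=> le_nu; rewrite raddf_sum raddf_sum /=.
pose nu' := BMultinom (mdeg_lem le_nu).
rewrite (bigD1 nu') //= big1 => [|mu /andP[le_mu /eqP ne_mu]].
  by rewrite mcoeffZ monoVE // mcoeffX eqxx mulr1 addr0.
rewrite mcoeffZ monoVE // mcoeffX; case: eqP => [/mnmP e|_]; last exact: mulr0.
case: ne_mu; apply/val_inj/mnmP => k /=.
by have := e (lshift m k); rewrite !mcatl.
Qed.

Lemma V_expansion {m} (lam : 'X_{1..m}) (p : V F lam) :
  p = \sum_(mu : 'X_{1..m < (mdeg lam).+1} | (mu <= lam)%MM)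
        (val p)@_(mcat mu (lam - mu)%MM) *: monoV F lam mu.
Proof.
apply/val_inj/mpolyP => nu.
have [/forallP nu_lam|nu_lam] :=
    boolP [forall k, nu (lshift m k) + nu (rshift m k) == lam k]%N.
  pose mu : 'X_{1..m} := [multinom nu (lshift m k) | k < m].
  have le_mu : (mu <= lam)%MM.
    by apply/mnm_lepP => k; rewrite mnmE -(eqP (nu_lam k)) leq_addr.
  have -> : nu = mcat mu (lam - mu)%MM.
    apply/mnmP => i; rewrite -(splitK i); case: (split i) => k /=.
      by rewrite mcatl mnmE.
    by rewrite mcatr mnmBE mnmE -(eqP (nu_lam k)) addKn.
  by rewrite (coefV_sum _ _ (fun mu => (val p)@_(mcat mu (lam - mu)%MM))).
(* A monomial of the wrong multidegree has coefficient zero in every element of [V F lam], hence on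
   both sides. *)
have coef0 (q : V F lam) : (val q)@_nu = 0.
  apply/eqP; apply: contraNT nu_lam => q_nu.
  by apply/forallP => k; rewrite (mhomogP _ _ (valP q)).
by rewrite !coef0.
Qed.

(** The weight shared by the apolarity form, the symbol and the expansion of an evaluation
    symbol. *)
Definition symb_coef {m} (lam mu : 'X_{1..m}) : F :=
  (mbinom lam mu)%:R * (-1) ^+ mdeg mu.

Definition mfactorial {m} (lam : 'X_{1..m}) : nat := (\prod_k (lam k)`!)%N.

Lemma mbinom_sub {m} (lam mu : 'X_{1..m}) :
  (mu <= lam)%MM -> mbinom lam (lam - mu)%MM = mbinom lam mu.
Proof.
move=> /mnm_lepP le_mu; apply: eq_bigr => k _.
by rewrite mnmBE bin_sub.
Qed.

Lemma mbinom_mfactorial {m} (lam mu : 'X_{1..m}) : (mu <= lam)%MM ->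
  (mbinom lam mu * (mfactorial mu * mfactorial (lam - mu)%MM))%N =
  mfactorial lam.
Proof.
move=> /mnm_lepP le_mu; rewrite -!big_split /=; apply: eq_bigr => k _.
by rewrite mnmBE bin_fact.
Qed.

Lemma mcoeff0_mderivm_mcat {m} (a b : 'X_{1..m}) (p : {mpoly F[m + m]}) :
  (p^`M[mcat a b])@_0%MM =
  p@_(mcat a b) * (mfactorial a * mfactorial b)%:R.
Proof.
rewrite mcoeff_mderivm addm0 mulr_natr big_split_ord /=.
by congr (_ *+ (_ * _)); apply: eq_bigr => k _; rewrite ?mcatl ?mcatr ffactnn.
Qed.

(** A derivative of full multidegree isolates a single coefficient, so the form is antidiagonal in
    the monomial basis. Each of the two derivatives contributes the same product of factorials,
    whence the square. *)
Lemma apolarE {m} (lam : 'X_{1..m}) (p q : V F lam) :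
  apolar p q =
  \sum_(mu : 'X_{1..m < (mdeg lam).+1} | (mu <= lam)%MM)
    symb_coef lam mu * (mfactorial mu * mfactorial (lam - mu)%MM)%:R ^+ 2 *
    ((val p)@_(mcat (lam - mu)%MM mu) * (val q)@_(mcat mu (lam - mu)%MM)).
Proof.
apply: eq_bigr => mu _; rewrite /symb_coef rmorphM /= !mcoeff0_mderivm_mcat.
by rewrite [(mfactorial (_ - _)%MM * _)%N]mulnC; ring.
Qed.

(* [Symb T] with its last [l] pairs of variables specialized to a point, [t mu]
   being the value there of [T(x^mu y^(lam - mu))]. *)
Definition kernelV {m} (lam : 'X_{1..m}) (t : 'X_{1..m} -> F) : V F lam :=
  \sum_(mu : 'X_{1..m < (mdeg lam).+1} | (mu <= lam)%MM)
    (symb_coef lam mu * t mu) *: monoV F lam (lam - mu)%MM.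

(** Reproducing property: the weights of the form and of the kernel multiply to a constant. The
    binomials turn the factorials into [mfactorial lam] squared, and the signs at [mu] and
    [lam - mu] combine to that of [lam]. *)
Lemma apolar_kernelV {m} (lam : 'X_{1..m}) (p : V F lam) t :
  apolar p (kernelV lam t) =
  (-1) ^+ mdeg lam * (mfactorial lam)%:R ^+ 2 *
  \sum_(mu : 'X_{1..m < (mdeg lam).+1} | (mu <= lam)%MM)
    (val p)@_(mcat mu (lam - mu)%MM) * t mu.
Proof.
rewrite (big_lem_rev _ lam (fun mu => (val p)@_(mcat mu (lam - mu)%MM) * t mu)).
rewrite apolarE mulr_sumr; apply: eq_bigr => mu le_mu.
pose a nu := symb_coef lam (lam - nu)%MM * t (lam - nu)%MM.
(* The kernel is rewritten in the indexing that [coefV_sum] reads off. *)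
have -> : kernelV lam t =
    \sum_(nu : 'X_{1..m < (mdeg lam).+1} | (nu <= lam)%MM)
      a nu *: monoV F lam nu.
  rewrite [RHS](big_lem_rev _ lam (fun nu => a nu *: monoV F lam nu)).
  by apply: eq_bigr => nu le_nu; rewrite /a lem_subK.
rewrite coefV_sum // {}/a lem_subK // /symb_coef mbinom_sub //.
have -> : (-1) ^+ mdeg lam = (-1) ^+ mdeg (lam - mu)%MM * (-1) ^+ mdeg mu :> F.
  by rewrite -exprD -mdegD submK.
have -> : (mfactorial lam)%:R = (mbinom lam mu)%:R *
    (mfactorial mu * mfactorial (lam - mu)%MM)%:R :> F.
  by rewrite -natrM mbinom_mfactorial.
by ring.
Qed.

(** * Values of the kernel, the symbol and evaluation symbols *)

Lemma meval_mcatX {m} (x y : 'I_m -> F) (a b : 'X_{1..m}) :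
  ('X_[mcat a b]).@[fcat x y] =
  (\prod_k x k ^+ a k) * (\prod_k y k ^+ b k).
Proof.
rewrite mevalX big_split_ord /=.
by congr (_ * _); apply: eq_bigr => k _; rewrite ?mcatl ?mcatr ?fcatl ?fcatr.
Qed.

Lemma meval_kernelV {m} (lam : 'X_{1..m}) t (z w : 'I_m -> F) :
  (val (kernelV lam t)).@[fcat z w] =
  \sum_(mu : 'X_{1..m < (mdeg lam).+1} | (mu <= lam)%MM)
    symb_coef lam mu *
    (\prod_k z k ^+ (lam - mu)%MM k * \prod_k w k ^+ mu k * t mu).
Proof.
rewrite raddf_sum raddf_sum /=; apply: eq_bigr => mu le_mu.
by rewrite mevalZ monoVE ?lem_subr // lem_subK // meval_mcatX; ring.
Qed.

Lemma meval_Symb {m l} (lam : 'X_{1..m}) (al : 'X_{1..l})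
    (T : V F lam -> V F al) (z w : 'I_(m + l) -> F) :
  (val (Symb T)).@[fcat z w] =
  \sum_(mu : 'X_{1..m < (mdeg lam).+1} | (mu <= lam)%MM)
    symb_coef lam mu *
    (\prod_k z (lshift l k) ^+ (lam - mu)%MM k *
     \prod_k w (lshift l k) ^+ mu k *
     (val (T (monoV F lam mu))).@[fcat (fun j => z (rshift m j))
                                       (fun j => w (rshift m j))]).
Proof.
rewrite raddf_sum /=; apply: eq_bigr => mu _.
rewrite mevalZ; congr (_ * _).
rewrite !mevalM !rmorph_prod /=; congr (_ * _ * _).
- by apply: eq_bigr => k _; rewrite rmorphXn /= mevalXU fcatl.
- by apply: eq_bigr => k _; rewrite rmorphXn /= mevalXU fcatr.
rewrite comp_mpoly_meval; apply: meval_eq => i.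
rewrite tnth_mktuple -(splitK i).
by case: (split i) => j /=; rewrite ?fcatl ?fcatr mevalXU ?fcatl ?fcatr.
Qed.

(** This is (zy - xw)^lambda. The expanded form makes it an element of [V F lam] at once and lets a
    linear [T] act term by term. *)
Definition eval_symbol {m} (lam : 'X_{1..m}) (z w : 'I_m -> F) : V F lam :=
  \sum_(mu : 'X_{1..m < (mdeg lam).+1} | (mu <= lam)%MM)
    (symb_coef lam mu *
     (\prod_k z k ^+ (lam - mu)%MM k * \prod_k w k ^+ mu k)) *: monoV F lam mu.

(** The binomial theorem in each factor, then [prod_sum_lem]. The signs fit the shape required by
    [evaluation_symbol], with b = -w and a = -z. *)
Lemma eval_symbolE {m} (lam : 'X_{1..m}) (z w : 'I_m -> F) :
  eval_symbol lam z w =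
  \prod_k (- w k *: xvar F k - - z k *: yvar F k) ^+ lam k :> {mpoly F[m + m]}.
Proof.
have expE k : (- w k *: xvar F k - - z k *: yvar F k) ^+ lam k =
    \sum_(i < (lam k).+1) ((-1) ^+ i * z k ^+ (lam k - i) * w k ^+ i *
      'C(lam k, i)%:R) *: (xvar F k ^+ i * yvar F k ^+ (lam k - i)).
  rewrite addrC !scaleNr opprK exprBn; apply: eq_bigr => i _.
  rewrite -!mul_mpolyC !rmorphM !rmorphXn rmorph_nat rmorphN1 -mulr_natr.
  by rewrite !exprMn; ring.
under eq_bigr => k _ do rewrite expE.
rewrite (prod_sum_lem _ lam (fun k i => ((-1) ^+ i * z k ^+ (lam k - i) *
  w k ^+ i * 'C(lam k, i)%:R) *: (xvar F k ^+ i * yvar F k ^+ (lam k - i)))).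
rewrite [LHS](raddf_sum val); apply: eq_bigr => mu le_mu.
rewrite /= monoVE // scaler_prod; congr (_ *: _).
  rewrite /symb_coef /mbinom natr_prod (mdegE mu) -prodrXr -!big_split /=.
  by apply: eq_bigr => k _; rewrite mnmBE; ring.
rewrite mpolyXE_id big_split_ord /= -big_split; apply: eq_bigr => k _.
by rewrite mcatl mcatr mnmBE.
Qed.

(** The witness is the kernel built from the values at [(x, y)] of the images of the monomials;
    expanding [p] in monomials, linearity of [T] turns the reproduced sum into the value of
    [T p]. *)
Lemma Symb_apolar {m l} (lam : 'X_{1..m}) (al : 'X_{1..l})
    (T : {linear V F lam -> V F al}) (p : V F lam) (x y : 'I_l -> F) :
  exists2 q : V F lam,
    forall z w : 'I_m -> F, (val q).@[fcat z w] =
      (val (Symb T)).@[fcat (fcat z x) (fcat w y)] &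
    apolar p q = (-1) ^+ mdeg lam * (mfactorial lam)%:R ^+ 2 *
                 (val (T p)).@[fcat x y].
Proof.
pose t mu := (val (T (monoV F lam mu))).@[fcat x y].
exists (kernelV lam t) => [z w|].
  rewrite meval_kernelV meval_Symb; apply: eq_bigr => mu _.
  congr (_ * (_ * _ * _)).
  - by apply: eq_bigr => k _; rewrite fcatl.
  - by apply: eq_bigr => k _; rewrite fcatl.
  apply: meval_eq => i; rewrite -(splitK i).
  by case: (split i) => j /=; rewrite ?fcatl ?fcatr.
rewrite apolar_kernelV; congr (_ * _).
rewrite [in RHS](V_expansion lam p) linear_sum raddf_sum raddf_sum /=.
by apply: eq_bigr => mu _; rewrite linearZ mevalZ.
Qed.

Lemma meval_Symb_eval_symbol {m l} (lam : 'X_{1..m}) (al : 'X_{1..l})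
    (T : {linear V F lam -> V F al}) (z w : 'I_(m + l) -> F) :
  (val (Symb T)).@[fcat z w] =
  (val (T (eval_symbol lam (fun k => z (lshift l k))
                           (fun k => w (lshift l k))))).@[
    fcat (fun j => z (rshift m j)) (fun j => w (rshift m j))].
Proof.
rewrite meval_Symb linear_sum raddf_sum raddf_sum /=.
by apply: eq_bigr => mu _; rewrite linearZ mevalZ !mulrA.
Qed.

(** * Stability and the equivalence *)

Lemma P1_repr_inj (u v : P1 F) :
  (val (repr u)).1 * (val (repr v)).2 = (val (repr u)).2 * (val (repr v)).1 ->
  u = v.
Proof.
move=> /eqP e; rewrite -[u]reprK -[v]reprK.
by apply/eqmodP; rewrite /= /proportional e.
Qed.

(** Up to sign, each linear factor is the determinant of the coordinates of [z k] and [c k], so it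
    vanishes only if these points coincide. *)
Lemma stable_eval_symbol {m} (lam : 'X_{1..m}) (C : 'I_m -> set (P1 F))
    (z : 'I_m -> P1 F) :
  (forall k, ~ C k (z k)) ->
  stable (prod_set C) (val (eval_symbol lam (fun k => (val (repr (z k))).1)
                                            (fun k => (val (repr (z k))).2))).
Proof.
move=> nCz c Cc; rewrite /vanishes /= eval_symbolE rmorph_prod /=.
apply/prodf_neq0 => k _; rewrite rmorphXn expf_neq0 //=.
rewrite mevalB !mevalZ !mevalXU /coord_point fcatl fcatr.
apply/eqP => e; apply: (nCz k); suff -> : z k = c k by exact: Cc.
apply: P1_repr_inj; apply/eqP; rewrite -subr_eq0 -e; apply/eqP.
by ring.
Qed.

Lemma stability_iff {m l} (lam : 'X_{1..m}) (al : 'X_{1..l})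
    (T : {linear V F lam -> V F al})
    (C B : 'I_m -> set (P1 F)) (S : 'I_l -> set (P1 F)) :
  disjoint_Grace_pair C B ->
  (forall j, S j !=set0)%classic ->
  [<-> forall p : V F lam, stable (prod_set C) p ->
         T p != 0 /\ stable (prod_set S) (T p);
       forall p : V F lam, evaluation_symbol p -> stable (prod_set C) p ->
         T p != 0 /\ stable (prod_set S) (T p);
       stable (prod_set (fcat B S)) (Symb T)].
Proof.
move=> [grace disj] Sn0; tfae.
- by move=> h p _; exact: h.
(* (ii) implies (iii): the first [m] coordinates of [s] determine the evaluation symbol, the last
   [l] the point [s'] at which its image is evaluated. *)
- move=> h s sBS; rewrite /vanishes meval_Symb_eval_symbol.
  pose s' : {ffun 'I_l -> P1 F} := [ffun j => s (rshift m j)].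
  pose z k := (val (repr (s (lshift l k)))).1.
  pose w k := (val (repr (s (lshift l k)))).2.
  have /h[|_ /(_ s')] : evaluation_symbol (eval_symbol lam z w).
  + exists (fun k => - z k), (fun k => - w k); split=> [j|].
      apply: contraNneq (valP (repr (s (lshift l j)))) => -[/eqP + /eqP].
      rewrite !oppr_eq0 /z /w; case: (val _) => u v /= /eqP-> /eqP->.
      by rewrite eqxx.
    exact: eval_symbolE.
  + apply: (stable_eval_symbol lam C (fun k => s (lshift l k))) => k Cs.
    have : (C k `&` B k)%classic (s (lshift l k)).
      by split=> //; have := sBS (lshift l k); rewrite fcatl.
    by rewrite disj.
  + have Ss' : prod_set S s'.
      by move=> j; rewrite ffunE; have := sBS (rshift m j); rewrite fcatr.
    move=> /(_ Ss'); rewrite /vanishes; congr (_ != _).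
    apply: meval_eq => i; rewrite /coord_point /fcat.
    by case: split => j; rewrite ffunE.
(* (iii) implies (i): [q] below is the symbol frozen at the coordinates of [s]. *)
- move=> h p Cp.
  have Tp s : prod_set S s -> ~~ vanishes (T p) s.
    move=> Ss.
    have [q qE apq] := Symb_apolar lam al T p (fun j => (val (repr (s j))).1)
                                           (fun j => (val (repr (s j))).2).
    have /(grace _ _ _ Cp) : stable (prod_set B) q.
      move=> z Bz; rewrite /vanishes qE.
      pose zs : {ffun 'I_(m + l) -> P1 F} := [ffun i => fcat z s i].
      have /h : prod_set (fcat B S) zs.
        by move=> i; rewrite ffunE /fcat; case: split => k; [exact: Bz|exact: Ss].
      (* Representatives are chosen componentwise, so the coordinates of the joined point are the
         joined coordinates. *)
      rewrite /vanishes; congr (_ != _); apply: meval_eq => i.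
      rewrite /coord_point /fcat; case: split => k; rewrite ffunE /fcat.
        by case: split.
      by case: split.
    by rewrite apq mulf_eq0 negb_or => /andP[].
  (* Stability on an empty set would not exclude zero; as every [S j] has a point, the zero
     polynomial would vanish somewhere on the product. *)
  split=> //; apply/eqP => Tp0.
  have /fin_all_exists[s Ss] j := Sn0 j.
  have /Tp : prod_set S [ffun j => s j] by move=> j; rewrite ffunE.
  by rewrite /vanishes Tp0 meval0 eqxx.
Qed.

End ApolarityKernel.

Theorem theorem6p2 (R : realType) (m l : nat)
    (lam : 'X_{1..m}) (al : 'X_{1..l})
    (T : {linear V R[i] lam -> V R[i] al})
    (C B : 'I_m -> set (P1 R[i])) (S : 'I_l -> set (P1 R[i])) :
  disjoint_Grace_pair C B ->
  (forall j, S j !=set0)%classic ->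
  [<-> (* (i) *)
       forall p : V R[i] lam, stable (prod_set C) p ->
         T p != 0 /\ stable (prod_set S) (T p);
       (* (ii) *)
       forall p : V R[i] lam, evaluation_symbol p -> stable (prod_set C) p ->
         T p != 0 /\ stable (prod_set S) (T p);
       (* (iii) *)
       stable (prod_set (fcat B S)) (Symb T)].
Proof. exact: stability_iff. Qed.
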